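(* There exist a finite relational vocabulary $\sigma$ and a Boolean query $\mathfrak{J}\subseteq\mathfrak{F}_\sigma$ that is $\mathbb{O}$-invariant elementary on $\mathfrak{F}_\sigma$ but is not elementary on $\mathfrak{F}_\sigma$ (i.e. there is no first-order $\sigma$-sentence $\psi$ with $\mathfrak{J}=\{\mathcal{A}\in\mathfrak{F}_\sigma:\mathcal{A}\models\psi\}$).
   Context: $\mathfrak{F}_\sigma$ is the class of finite $\sigma$-structures. Gaifman graph $\mathcal{G}(\mathcal{A})$: vertices are the elements of $\mathcal{A}$; distinct $a,a'$ are adjacent iff they occur together in some tuple of some relation of $\mathcal{A}$; neighbors of $a$ are the vertices adjacent to $a$. A local order on $\mathcal{A}$ is a ternary relation $\preceq$ such that $\preceq(a,b,c)$ implies $b,c$ are neighbors of $a$, and for each fixed $a$, $\{(b,c):\preceq(a,b,c)\}$ is a linear order on the neighbors of $a$. A first-order sentence $\theta$ in vocabulary $\sigma\cup\{\preceq\}$ is $\mathbb{O}$-invariant on $\mathfrak{F}_\sigma$ if for every $\mathcal{A}\in\mathfrak{F}_\sigma$ either all expansions $(\mathcal{A},\preceq)$ by a local order satisfy $\theta$ or none does; $\mathfrak{J}$ is $\mathbb{O}$-invariant elementary on $\mathfrak{F}_\sigma$ if for some such $\theta$, for all $\mathcal{A}\in\mathfrak{F}_\sigma$, $\mathcal{A}\in\mathfrak{J}$ iff some expansion of $\mathcal{A}$ by a local order satisfies $\theta$. *)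

(* Defs.v *)
From mathcomp Require Import all_boot.

Set Implicit Arguments.
Unset Strict Implicit.
Unset Printing Implicit Defensive.

Record vocabulary := Vocabulary {
  symbol : finType;
  arity : symbol -> nat;
  arity_gt0 : forall R, 0 < arity R
}.

(* As usual in finite model theory, universes are nonempty. *)
Record structure (V : vocabulary) := Structure {
  carrier :> finType;
  carrier_gt0 : 0 < #|carrier|;
  interp : forall R : symbol V, {set (arity R).-tuple carrier}
}.

(* First-order logic with equality.  [formula V n] is the type of formulas     *)
(* whose free variables are among n de Bruijn indices; [FEx] binds index 0.    *)
Inductive formula (V : vocabulary) : nat -> Type :=
| FEq n of 'I_n & 'I_n : formula V n
| FRel n (R : symbol V) of (arity R).-tuple 'I_n : formula V n
| FNot n of formula V n : formula V n
| FAnd n of formula V n & formula V n : formula V n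
| FEx n of formula V n.+1 : formula V n.

Definition sentence (V : vocabulary) := formula V 0.

Fixpoint sat (V : vocabulary) (A : structure V) n (phi : formula V n) :
    n.-tuple A -> bool :=
  match phi in formula _ m return m.-tuple A -> bool with
  | FEq _ i j => fun e => tnth e i == tnth e j
  | FRel _ R t => fun e => map_tuple (tnth e) t \in interp A R
  | FNot _ psi => fun e => ~~ sat psi e
  | FAnd _ psi chi => fun e => sat psi e && sat chi e
  | FEx _ psi => fun e => [exists a : A, sat psi (cons_tuple a e)]
  end.

Definition models (V : vocabulary) (A : structure V) (phi : sentence V) : bool :=
  sat phi [tuple of [::] : seq A].

Definition isomorphic (V : vocabulary) (A B : structure V) : Prop :=
  exists2 f : A -> B, bijective f &
    forall (R : symbol V) (t : (arity R).-tuple A),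
      (map_tuple f t \in interp B R) = (t \in interp A R).

Definition boolean_query (V : vocabulary) (J : structure V -> Prop) : Prop :=
  forall A B : structure V, isomorphic A B -> (J A <-> J B).

Definition elementary (V : vocabulary) (J : structure V -> Prop) : Prop :=
  exists psi : sentence V, forall A : structure V, J A <-> models A psi.

Definition gaifman (V : vocabulary) (A : structure V) : rel A := fun a b =>
  (a != b) &&
  [exists R : symbol V, [exists t in interp A R, (a \in t) && (b \in t)]].

(* [le a] is a (reflexive) linear order on the Gaifman neighbors of [a].       *)
Definition local_order (V : vocabulary) (A : structure V) (le : A -> rel A) :
    Prop :=
  forall a : A,
    [/\ forall b c, le a b c -> gaifman a b && gaifman a c,
        {in gaifman a, reflexive (le a)},
        {in gaifman a &, antisymmetric (le a)},
        {in gaifman a & &, transitive (le a)} &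
        {in gaifman a &, total (le a)}].

(* The added ternary symbol is [None].                                         *)
Definition lo_arity (V : vocabulary) (R : option (symbol V)) : nat :=
  if R is Some R' then arity R' else 3.

Lemma lo_arity_gt0 (V : vocabulary) (R : option (symbol V)) : 0 < lo_arity R.
Proof. by case: R => [R|] //=; apply: arity_gt0. Qed.

Definition lo_vocabulary (V : vocabulary) : vocabulary :=
  Vocabulary (@lo_arity_gt0 V).

Definition lo_interp (V : vocabulary) (A : structure V) (le : A -> rel A)
    (R : option (symbol V)) : {set (lo_arity R).-tuple A} :=
  match R with
  | Some R' => interp A R'
  | None => [set t : 3.-tuple A |
      le (tnth t (@Ordinal 3 0 isT)) (tnth t (@Ordinal 3 1 isT))
         (tnth t (@Ordinal 3 2 isT))]
  end.

Definition lo_expansion (V : vocabulary) (A : structure V) (le : A -> rel A) :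
    structure (lo_vocabulary V) :=
  @Structure (lo_vocabulary V) A (carrier_gt0 A) (lo_interp le).

Definition lo_invariant (V : vocabulary) (theta : sentence (lo_vocabulary V)) :
    Prop :=
  forall A : structure V,
    (forall le : A -> rel A,
      local_order le -> models (lo_expansion le) theta) \/
    (forall le : A -> rel A,
      local_order le -> ~ models (lo_expansion le) theta).

Definition lo_invariant_elementary (V : vocabulary) (J : structure V -> Prop) :
    Prop :=
  exists2 theta : sentence (lo_vocabulary V), lo_invariant theta &
    forall A : structure V,
      J A <->
      exists2 le : A -> rel A, local_order le & models (lo_expansion le) theta.

(* Main.v *)
(* The query is Gurevich's: the even number of atoms of a finite powerset      *)
(* [({set X}, \subset)]. The bottom element is a Gaifman neighbor of every     *)
(* other element, so a local order at the bottom linearly orders the atoms;    *)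
(* evenness is then expressed by an element containing every other atom, the   *)
(* first one but not the last one. A first-order axiom (an atom can be         *)
(* adjoined to any element) makes every set of atoms representable in every    *)
(* finite model, which gives invariance. Non-elementarity is an                *)
(* Ehrenfeucht-Fraisse argument: the powersets of two sets with at least       *)
(* [2 ^ q] points agree up to rank [q], because a position is determined up to *)
(* similarity by the sizes, cut off at [2 ^ q], of the cells that the chosen   *)
(* subsets generate.                                                           *)
Require Import Defs.
From mathcomp Require Import all_boot zify.

Set Implicit Arguments.
Unset Strict Implicit.
Unset Printing Implicit Defensive.

(** * Back-and-forth systems *)

(** On a finite linear order, some subset contains the first point, misses the last and alternates
    at successive points exactly when the number of points is even ([alternating_even],
    [even_alternating]). This is first-order as soon as elements of the structure can stand for
    subsets. The query reads its binary relation as inclusion and includes two first-order axioms: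
    some bottom has no atom below it, and any atom can be adjoined to any element. By finiteness,
    every set of atoms is then the set of atoms below some element ([atoms_representable]), in any
    finite model of the axioms. A bottom is adjacent to every other element, so the local order at
    it linearly orders the atoms. Whether an alternating set exists depends only on the number of
    atoms, not on the order or the bottom chosen; this gives invariance ([models_even_atomsP]).

    Without an order, large powersets look alike. With q rounds left in the Ehrenfeucht-Fraisse
    game, two tuples of subsets are similar when the cells they generate have the same sizes up to
    the cutoff [2 ^ q]. A new subset cuts each cell in two, and the cut can be copied on the other
    side at half the cutoff ([split_threshold], [cell_similar_forth]). So sentences of rank q do not
    separate powersets of sets with at least [2 ^ q] points ([powerset_equiv]), in particular of
    sets with n and n + 1 points. *)

Fixpoint qrank V n (phi : formula V n) : nat :=
  match phi with
  | FEq _ _ _ | FRel _ _ _ => 0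
  | FNot _ psi => qrank psi
  | FAnd _ psi chi => maxn (qrank psi) (qrank chi)
  | FEx _ psi => (qrank psi).+1
  end.

Section BackAndForth.

Variables (V : vocabulary) (A B : structure V).
Variable Z : nat -> forall n, n.-tuple A -> n.-tuple B -> Prop.

Hypothesis Z_eq : forall q n (e : n.-tuple A) (e' : n.-tuple B) i j,
  Z q e e' -> (tnth e i == tnth e j) = (tnth e' i == tnth e' j).
Hypothesis Z_rel : forall q n (e : n.-tuple A) (e' : n.-tuple B) R
    (t : (arity R).-tuple 'I_n), Z q e e' ->
  (map_tuple (tnth e) t \in interp A R) =
  (map_tuple (tnth e') t \in interp B R).
Hypothesis Z_forth : forall q n (e : n.-tuple A) (e' : n.-tuple B) a,
  Z q.+1 e e' -> exists b, Z q (cons_tuple a e) (cons_tuple b e').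
Hypothesis Z_back : forall q n (e : n.-tuple A) (e' : n.-tuple B) b,
  Z q.+1 e e' -> exists a, Z q (cons_tuple a e) (cons_tuple b e').

(** [Z q] relates positions with q rounds left; each quantifier spends one round. *)
Lemma back_and_forth n (phi : formula V n) q (e : n.-tuple A)
    (e' : n.-tuple B) : qrank phi <= q -> Z q e e' -> sat phi e = sat phi e'.
Proof.
elim: n / phi q e e' => [n i j|n R t|n psi IH|n psi IH1 chi IH2|n psi IH]
    q e e' /=.
- by move=> _; apply: Z_eq.
- by move=> _; apply: Z_rel.
- by move=> le_q Zee'; rewrite (IH q _ e').
- by rewrite geq_max => /andP[le1 le2] Zee'; rewrite (IH1 q _ e') ?(IH2 q _ e').
- case: q => // q le_q Zee'; apply/existsP/existsP => [[a]|[b]] sat_ab.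
    by have [b Zab] := Z_forth a Zee'; exists b; rewrite -(IH q _ _ le_q Zab).
  by have [a Zab] := Z_back b Zee'; exists a; rewrite (IH q _ _ le_q Zab).
Qed.

End BackAndForth.

(** * Powersets *)

Definition binary_voc : vocabulary :=
  @Vocabulary unit (fun=> 2) (fun=> isT).

Definition edge (A : structure binary_voc) : rel A :=
  fun a b => [tuple a; b] \in interp A tt.

Lemma powerset_gt0 (X : finType) : 0 < #|{set X}|.
Proof. by apply/card_gt0P; exists set0. Qed.

Definition powerset_structure (X : finType) : structure binary_voc :=
  @Structure binary_voc {set X} (powerset_gt0 X)
    (fun=> [set t : 2.-tuple {set X} | tnth t ord0 \subset tnth t ord_max]).

Lemma edge_powerset X (s t : powerset_structure X) :
  edge s t = ((s : {set X}) \subset (t : {set X})).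
Proof. by rewrite /edge inE. Qed.

Section Cells.

Variable X : finType.

(** The nonempty cells are the atoms of the Boolean algebra generated by [e]. *)
Definition cell n (e : n.-tuple {set X}) (tau : n.-tuple bool) : {set X} :=
  [set x | map_tuple (fun s : {set X} => x \in s) e == tau].

Lemma cell_cons n s (e : n.-tuple {set X}) b tau :
  cell (cons_tuple s e) (cons_tuple b tau) =
  [set x in cell e tau | (x \in s) == b].
Proof. by apply/setP=> x; rewrite !inE -!val_eqE /= eqseq_cons andbC. Qed.

Lemma subset_of_card (B : {set X}) k :
  k <= #|B| -> exists2 C : {set X}, C \subset B & #|C| = k.
Proof.
move=> le_kB; exists [set x in take k (enum B)].
  by apply/subsetP=> x; rewrite inE => /mem_take; rewrite mem_enum.
rewrite cardsE (card_uniqP _) ?take_uniq ?enum_uniq // size_take_min -cardE.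
exact/minn_idPl.
Qed.

End Cells.

Definition cell_similar (X Y : finType) q n (e : n.-tuple {set X})
    (e' : n.-tuple {set Y}) : Prop :=
  forall tau, minn #|cell e tau| (2 ^ q) = minn #|cell e' tau| (2 ^ q).

Lemma cell_similar_sym X Y q n (e : n.-tuple {set X}) (e' : n.-tuple {set Y}) :
  cell_similar q e e' -> cell_similar q e' e.
Proof. by move=> sim tau. Qed.

(** The cutoff [2 ^ q] is positive, so similar tuples have the same nonempty cells; inclusions
    between the sets depend on nothing else. *)
Lemma cell_similar_point X Y q n (e : n.-tuple {set X}) (e' : n.-tuple {set Y})
    x :
  cell_similar q e e' ->
  exists y, forall i, (x \in tnth e i) = (y \in tnth e' i).
Proof.
pose tau := map_tuple (fun s : {set X} => x \in s) e.
move=> /(_ tau) sim; have x_cell : 0 < #|cell e tau|.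
  by apply/card_gt0P; exists x; rewrite inE.
have : 0 < #|cell e' tau|.
  by have := expn_gt0 2 q; rewrite /=; lia.
case/card_gt0P=> y; rewrite inE => /eqP y_cell; exists y => i.
by have := congr1 (fun t => tnth t i) y_cell; rewrite !tnth_map.
Qed.

Lemma cell_similar_subset X Y q n (e : n.-tuple {set X})
    (e' : n.-tuple {set Y}) i j :
  cell_similar q e e' ->
  (tnth e i \subset tnth e j) = (tnth e' i \subset tnth e' j).
Proof.
move=> sim; apply/subsetP/subsetP => sub x.
  have [y xy] := cell_similar_point x (cell_similar_sym sim).
  by rewrite !xy; apply: sub.
by have [y xy] := cell_similar_point x sim; rewrite !xy; apply: sub.
Qed.

(** Below the cutoff, [m] and [m'] are equal and the split is copied. Above it, a part smaller than
    [p] is copied exactly and the other part is large on both sides; if both parts are large, [p]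
    and the rest will do. *)
Lemma split_threshold p m m' u : u <= m -> minn m (p + p) = minn m' (p + p) ->
  exists2 u', u' <= m' &
    minn u p = minn u' p /\ minn (m - u) p = minn (m' - u') p.
Proof.
move=> le_um eq_mm'.
have [lt_m|ge_m] := ltnP m (p + p); first by exists u; lia.
have [lt_u|ge_u] := ltnP u p; first by exists u; lia.
have [lt_mu|ge_mu] := ltnP (m - u) p; first by exists (m' - (m - u)); lia.
by exists p; lia.
Qed.

Lemma cell_similar_forth X Y q n (e : n.-tuple {set X}) (e' : n.-tuple {set Y})
    s :
  cell_similar q.+1 e e' ->
  exists s', cell_similar q (cons_tuple s e) (cons_tuple s' e').
Proof.
move=> sim.
have pick_sub tau : exists C : {set Y}, [/\ C \subset cell e' tau,
    minn #|cell e tau :&: s| (2 ^ q) = minn #|C| (2 ^ q) &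
    minn #|cell e tau :\: s| (2 ^ q) = minn #|cell e' tau :\: C| (2 ^ q)].
  have := sim tau; rewrite expnS mul2n -addnn.
  case/(split_threshold (subset_leq_card (subsetIl _ s))) => u' le_u' [eq1 eq2].
  have [C sub_C card_C] := subset_of_card le_u'.
  exists C; split=> //; first by rewrite card_C.
  by rewrite [#|_ :\: s|]cardsD [#|_ :\: C|]cardsD (setIidPr sub_C) card_C.
have [F F_P] := fin_all_exists pick_sub.
(* The answer is glued from the subsets [F tau]: each point consults the one chosen in its own
   cell. *)
exists [set y | y \in F (map_tuple (fun t : {set Y} => y \in t) e')].
move=> tau; case/tupleP: tau => b tau.
rewrite (_ : [tuple of b :: tau] = cons_tuple b tau); last exact: val_inj.
have [/subsetP sub_F eq1 eq2] := F_P tau; rewrite !cell_cons.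
have in_F y : y \in cell e' tau ->
    (y \in F (map_tuple (fun t : {set Y} => y \in t) e')) = (y \in F tau).
  by rewrite inE => /eqP ->.
case: b.
  rewrite (_ : [set x in _ | _] = cell e tau :&: s); last first.
    by apply/setP=> x; rewrite !inE eqb_id.
  rewrite eq1 (_ : [set x in _ | _] = F tau) //.
  apply/setP=> y; rewrite [LHS]inE; have [y_cell|y_cell] /= := boolP (y \in _).
    by rewrite inE in_F // eqb_id.
  by apply/esym/negbTE; apply: contra y_cell; apply: sub_F.
rewrite (_ : [set x in _ | _] = cell e tau :\: s); last first.
  by apply/setP=> x; rewrite !inE eqbF_neg andbC.
rewrite eq2 (_ : [set x in _ | _] = cell e' tau :\: F tau) //.
apply/setP=> y; rewrite [LHS]inE [RHS]inE andbC.
have [y_cell|y_cell] /= := boolP (y \in cell _ _); last by rewrite !andbF.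
by rewrite inE in_F // eqbF_neg.
Qed.

Lemma powerset_equiv (X Y : finType) (psi : sentence binary_voc) :
  2 ^ qrank psi <= #|X| -> 2 ^ qrank psi <= #|Y| ->
  models (powerset_structure X) psi = models (powerset_structure Y) psi.
Proof.
move=> leX leY.
pose Z q n (e : n.-tuple (powerset_structure X))
  (e' : n.-tuple (powerset_structure Y)) := @cell_similar X Y q n e e'.
apply: (@back_and_forth _ _ _ Z) (leqnn _) _ => //.
- move=> q n e e' i j sim.
  by rewrite !eqEsubset !(cell_similar_subset _ _ sim).
- move=> q n e e' [] t sim; rewrite !inE !tnth_map.
  exact: (cell_similar_subset _ _ sim).
- by move=> q n e e' a; apply: cell_similar_forth.
- move=> q n e e' b /cell_similar_sym /(cell_similar_forth b)[a sim].
  by exists a; apply: cell_similar_sym.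
(* At the start no subset is chosen, and the only cell is the whole set. *)
- move=> tau; have cellT T : @cell T 0 [tuple of [::]] tau = [set: T].
    by apply/setP=> x; rewrite !inE (tuple0 tau); apply/eqP/val_inj.
  by rewrite !cellT !cardsT (minn_idPr leX) (minn_idPr leY).
Qed.

(** * Alternating predicates on a finite linear order *)

(** Everything is relativized to [D] because [r] will be a local order, known to be linear only on
    neighbors. The last clause concerns a point [x] and its successor [y] in [D]. *)
Definition alternating (T : finType) (D : pred T) (r : rel T) (P : pred T) :
    bool :=
  [&& [forall x, D x ==> [forall y, D y ==> r x y] ==> P x],
      [forall x, D x ==> [forall y, D y ==> r y x] ==> ~~ P x] &
      [forall x, forall y, D x && D y && (x != y) && r x y ==>
         [forall z, D z ==> r z x || r y z] ==> (P x == ~~ P y)]].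

Section Alternating.

Variables (T : finType) (D : pred T) (r : rel T).

Lemma alternatingP (P : pred T) :
  reflect [/\ forall x, D x -> (forall y, D y -> r x y) -> P x,
              forall x, D x -> (forall y, D y -> r y x) -> ~~ P x &
              forall x y, D x -> D y -> x != y -> r x y ->
                (forall z, D z -> r z x || r y z) -> P x = ~~ P y]
    (alternating D r P).
Proof.
apply: (iffP and3P) => -[fst_P lst_P succ_P]; split.
- move=> x Dx min_x; have /implyP/(_ Dx)/implyP := forallP fst_P x; apply.
  by apply/forallP=> y; apply/implyP/min_x.
- move=> x Dx max_x; have /implyP/(_ Dx)/implyP := forallP lst_P x; apply.
  by apply/forallP=> y; apply/implyP/max_x.
- move=> x y Dx Dy neq_xy r_xy no_z; apply/eqP.
  have /forallP/(_ y) := forallP succ_P x.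
  rewrite Dx Dy neq_xy r_xy /= => /implyP; apply.
  by apply/forallP=> z; apply/implyP/no_z.
- apply/forallP=> x; apply/implyP=> Dx; apply/implyP=> /forallP min_x.
  by apply: fst_P => // y; apply/implyP.
- apply/forallP=> x; apply/implyP=> Dx; apply/implyP=> /forallP max_x.
  by apply: lst_P => // y; apply/implyP.
- apply/forallP=> x; apply/forallP=> y.
  apply/implyP=> /andP[/andP[/andP[Dx Dy] neq_xy] r_xy].
  apply/implyP=> /forallP no_z; apply/eqP/succ_P => // z.
  exact/implyP.
Qed.

Lemma eq_alternating (P Q : pred T) :
  {in D, P =1 Q} -> alternating D r P -> alternating D r Q.
Proof.
move=> eqPQ /alternatingP[fst_P lst_P succ_P]; apply/alternatingP; split.
- by move=> x Dx; rewrite -eqPQ //; apply: fst_P.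
- by move=> x Dx; rewrite -eqPQ //; apply: lst_P.
- by move=> x y Dx Dy; rewrite -!eqPQ //; apply: succ_P.
Qed.

Hypotheses (r_refl : {in D, reflexive r}) (r_anti : {in D &, antisymmetric r}).
Hypotheses (r_trans : {in D & &, transitive r}) (r_total : {in D &, total r}).

Lemma linear_enumeration :
  exists s : seq T, [/\ uniq s, s =i D, size s = #|D| &
    forall x0 i j, i < size s -> j < size s ->
      r (nth x0 s i) (nth x0 s j) = (i <= j)].
Proof.
exists (sort r (enum D)).
have s_D : sort r (enum D) =i D by move=> x; rewrite mem_sort mem_enum.
have all_D : all D (enum D) by apply/allP=> x; rewrite mem_enum.
have s_uniq : uniq (sort r (enum D)) by rewrite sort_uniq enum_uniq.
split=> //; first by rewrite size_sort -cardE.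
move=> x0 i j lt_i lt_j.
have s_sorted : sorted r (sort r (enum D)).
  exact: (sort_sorted_in r_total all_D).
have s_allD : all D (sort r (enum D)) by rewrite all_sort.
have mono k l : k < size (sort r (enum D)) -> l < size (sort r (enum D)) ->
    k <= l -> r (nth x0 (sort r (enum D)) k) (nth x0 (sort r (enum D)) l).
  by move=> *; apply: (sorted_leq_nth_in r_trans r_refl x0 s_allD s_sorted).
apply/idP/idP=> [r_ij|]; last exact: mono.
rewrite leqNgt; apply/negP=> lt_ji.
have /eqP : nth x0 (sort r (enum D)) i = nth x0 (sort r (enum D)) j.
  apply: r_anti; try by rewrite -s_D mem_nth.
  by rewrite r_ij mono // ltnW.
by rewrite nth_uniq // gtn_eqF.
Qed.

Lemma alternating_even (P : pred T) : alternating D r P -> ~~ odd #|D|.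
Proof.
case/alternatingP=> fst_P lst_P succ_P; apply/negP=> odd_D.
have [s [s_uniq s_D size_s r_nth]] := linear_enumeration.
have s_gt0 : 0 < size s by rewrite size_s; case: #|D| odd_D.
case: s => // x0 s' in s_uniq s_D size_s r_nth s_gt0 *.
set s := x0 :: s' in s_uniq s_D size_s r_nth s_gt0 *.
have nthD i : i < size s -> D (nth x0 s i).
  by move=> lt_i; have := mem_nth x0 lt_i; rewrite s_D.
have nthP y : D y -> exists2 i, i < size s & y = nth x0 s i.
  move=> Dy; have y_s : y \in s by rewrite s_D.
  by exists (index y s); rewrite ?index_mem ?nth_index.
(* Counting from 0, [P] holds exactly at even positions; with an odd number of points the last
   position is even, where [P] must fail. *)
have P_nth i : i < size s -> P (nth x0 s i) = ~~ odd i.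
  elim: i => [|i IH] lt_i.
    apply: fst_P => [|y /nthP[j lt_j ->]]; first exact: nthD.
    by rewrite r_nth.
  have lt_i' := ltnW lt_i.
  rewrite /= -IH // (succ_P (nth x0 s i) (nth x0 s i.+1)) ?negbK //.
  - exact: nthD.
  - exact: nthD.
  - by rewrite nth_uniq // ltn_eqF.
  - by rewrite r_nth.
  - by move=> z /nthP[j lt_j ->]; rewrite !r_nth //; lia.
have lt_last : (size s).-1 < size s by rewrite ltn_predL.
have : ~~ P (nth x0 s (size s).-1).
  apply: lst_P => [|y /nthP[j lt_j ->]]; first exact: nthD.
  by rewrite r_nth //; lia.
by rewrite P_nth // negbK; move: odd_D; rewrite -size_s /= => /negP.
Qed.

Lemma even_alternating : ~~ odd #|D| -> exists P, alternating D r P.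
Proof.
move=> even_D; have [s [s_uniq s_D size_s r_nth]] := linear_enumeration.
have r_index x y : D x -> D y -> r x y = (index x s <= index y s).
  move=> Dx Dy; have [x_s y_s] : x \in s /\ y \in s by rewrite !s_D.
  by rewrite -{1}(nth_index x x_s) -{1}(nth_index x y_s) r_nth ?index_mem.
have lt_index x : D x -> index x s < size s by rewrite index_mem s_D.
have nthD x0 i : i < size s -> D (nth x0 s i).
  by move=> lt_i; have := mem_nth x0 lt_i; rewrite s_D.
exists (fun x => ~~ odd (index x s)); apply/alternatingP; split.
- move=> x Dx min_x; have s_gt0 := leq_ltn_trans (leq0n _) (lt_index x Dx).
  have := min_x _ (nthD x _ s_gt0); rewrite r_index ?nthD // index_uniq //.
  by rewrite leqn0 => /eqP ->.
- move=> x Dx max_x; have lt_x := lt_index x Dx.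
  have lt_last : (size s).-1 < size s by lia.
  have := max_x _ (nthD x _ lt_last); rewrite r_index ?nthD // index_uniq //.
  move: even_D; rewrite -size_s; lia.
- move=> x y Dx Dy neq_xy; rewrite r_index // => le_xy no_z.
  have lt_x := lt_index x Dx; have lt_y := lt_index y Dy.
  have neq_index : index x s != index y s.
    apply: contra neq_xy => /eqP eq_index.
    rewrite -(nth_index x (_ : x \in s)) ?s_D // eq_index.
    by rewrite nth_index // s_D.
  have lt_Sx : (index x s).+1 < size s by lia.
  (* The point just after [x] is not at or before [x], so [y] is at or before it, hence equal to
     it. *)
  have := no_z _ (nthD x _ lt_Sx); rewrite !r_index ?nthD // index_uniq //.
  move=> le_z; have -> : index y s = (index x s).+1 by lia.
  by rewrite /= negbK.
Qed.

End Alternating.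

(** * The query *)

Section Query.

Variables (T : finType) (E : rel T).

Definition bottom : pred T := fun x => [forall y, E x y].

Definition atom : pred T := fun x =>
  ~~ bottom x && [forall y, E y x ==> bottom y || (y == x)].

(** In an arbitrary relation an atom may still be related to a bottom. Ruling this out makes [h]
    represent the empty set of atoms. *)
Definition atomless_bottom : pred T := fun h =>
  bottom h && [forall x, atom x ==> ~~ E x h].

Definition atom_adjoining : bool :=
  [forall s, forall a, atom a ==>
    [exists s', forall x, atom x ==> (E x s' == E x s || (x == a))]].

Lemma atoms_representable h (P : pred T) : atomless_bottom h ->
  atom_adjoining -> exists s, {in atom, (fun x => E x s) =1 P}.
Proof.
move=> /andP[_ /forallP h_empty] adjoin.
have rep (l : seq T) : exists s, {in atom, forall x, E x s = (x \in l) && P x}.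
  elim: l => [|a l [s s_l]].
    exists h => x At_x; have /implyP/(_ At_x)/negbTE := h_empty x.
    by rewrite in_nil.
  (* Only atoms satisfying [P] are adjoined; any other [a] leaves the represented set unchanged. *)
  have [At_a|nAt_a] := boolP (atom a && P a); last first.
    exists s => x At_x; rewrite s_l // in_cons.
    case: eqP => [eq_xa|//]; move: nAt_a.
    rewrite -eq_xa (At_x : atom x) /= => /negbTE ->.
    by rewrite andbF.
  case/andP: At_a => At_a Pa.
  have /forallP/(_ a)/implyP/(_ At_a)/existsP[s' /forallP s'_P] :=
    forallP adjoin s.
  exists s' => x At_x; have /implyP/(_ At_x)/eqP -> := s'_P x.
  by rewrite s_l // in_cons orbC; case: eqP => [->|].
have [s s_P] := rep (enum T); exists s => x At_x.
by rewrite s_P // mem_enum.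
Qed.

End Query.

Definition even_atoms (A : structure binary_voc) : Prop :=
  [/\ [exists h, atomless_bottom (@edge A) h], atom_adjoining (@edge A) &
      ~~ odd #|atom (@edge A)|].

(** * Invariance of the query under isomorphism *)

Lemma forall_bij (T U : finType) (f : T -> U) (P : pred U) :
  bijective f -> [forall y, P y] = [forall x, P (f x)].
Proof.
case=> g _ gK; apply/forallP/forallP => P_all x; first exact: P_all.
by rewrite -(gK x).
Qed.

Lemma exists_bij (T U : finType) (f : T -> U) (P : pred U) :
  bijective f -> [exists y, P y] = [exists x, P (f x)].
Proof.
move=> f_bij; apply: negb_inj.
by rewrite !negb_exists (forall_bij _ f_bij).
Qed.

Section QueryIso.

Variables (T U : finType) (E : rel T) (E' : rel U) (f : T -> U).
Hypotheses (f_bij : bijective f) (fE : forall x y, E' (f x) (f y) = E x y).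

Lemma bottom_iso x : bottom E' (f x) = bottom E x.
Proof.
by rewrite /bottom (forall_bij _ f_bij); apply: eq_forallb => y; rewrite fE.
Qed.

Lemma atom_iso x : atom E' (f x) = atom E x.
Proof.
rewrite /atom bottom_iso (forall_bij _ f_bij); congr (_ && _).
apply: eq_forallb => y.
by rewrite fE bottom_iso (inj_eq (bij_inj f_bij)).
Qed.

Lemma atomless_bottom_iso x : atomless_bottom E' (f x) = atomless_bottom E x.
Proof.
rewrite /atomless_bottom bottom_iso (forall_bij _ f_bij); congr (_ && _).
by apply: eq_forallb => y; rewrite fE atom_iso.
Qed.

Lemma atom_adjoining_iso : atom_adjoining E' = atom_adjoining E.
Proof.
rewrite /atom_adjoining (forall_bij _ f_bij); apply: eq_forallb => s.
rewrite (forall_bij _ f_bij); apply: eq_forallb => a.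
rewrite atom_iso (exists_bij _ f_bij); congr (_ ==> _).
apply: eq_existsb => s'; rewrite (forall_bij _ f_bij).
by apply: eq_forallb => x; rewrite atom_iso !fE (inj_eq (bij_inj f_bij)).
Qed.

Lemma card_atom_iso : #|atom E'| = #|atom E|.
Proof.
rewrite -(card_image (bij_inj f_bij) (atom E)); apply: eq_card => y.
have [g fK gK] := f_bij; rewrite -[y in LHS]gK -[y in RHS]gK.
by rewrite (mem_image (bij_inj f_bij)) -!topredE /= atom_iso.
Qed.

End QueryIso.

Lemma even_atoms_boolean_query : boolean_query even_atoms.
Proof.
move=> A B [f f_bij f_interp].
have fE x y : edge (f x) (f y) = edge x y.
  rewrite /edge -f_interp.
  by rewrite (_ : map_tuple f _ = [tuple f x; f y]) //; apply: val_inj.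
rewrite /even_atoms (exists_bij _ f_bij) (atom_adjoining_iso f_bij fE).
rewrite (card_atom_iso f_bij fE).
under [in X in _ <-> X]eq_existsb => x.
  by rewrite (atomless_bottom_iso f_bij fE) over.
by [].
Qed.

(** * The query on powersets, and non-elementarity *)

Lemma even_atoms_powerset (X : finType) :
  even_atoms (powerset_structure X) <-> ~~ odd #|X|.
Proof.
set E := @edge (powerset_structure X).
have bottomE s : bottom E s = (s == set0).
  apply/forallP/eqP => [s_bot | -> t]; last by rewrite /E edge_powerset sub0set.
  by apply/eqP; rewrite -subset0 -edge_powerset; apply: s_bot.
have atomE s : atom E s = (s \in [set [set x] | x : X]).
  rewrite /atom bottomE.
  apply/andP/imsetP => [[s_n0 /forallP s_min] | [x _ ->]].
    have /set0Pn[x x_s] := s_n0; exists x => //.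
    have := s_min [set x]; rewrite /E edge_powerset sub1set x_s bottomE /=.
    rewrite -cards_eq0 cards1 /=.
    by move/eqP.
  split; first by rewrite -cards_eq0 cards1.
  apply/forallP=> t; rewrite /E edge_powerset bottomE subset1 orbC.
  exact/implyP.
have card_atom : #|atom E| = #|X|.
  rewrite -(card_imset _ (@set1_inj X)); apply: eq_card => s.
  by rewrite -topredE /= atomE.
rewrite /even_atoms card_atom; split=> [[]|even_X] //; split=> //.
- apply/existsP; exists set0; rewrite /atomless_bottom bottomE eqxx /=.
  apply/forallP=> s; apply/implyP; rewrite atomE => /imsetP[x _ ->].
  by rewrite edge_powerset sub1set inE.
- apply/forallP=> s; apply/forallP=> a; apply/implyP; rewrite atomE.
  case/imsetP=> x _ ->; apply/existsP; exists (x |: s : {set X}).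
  apply/forallP=> t; apply/implyP; rewrite atomE => /imsetP[y _ ->].
  rewrite !edge_powerset !sub1set !inE orbC.
  by rewrite (inj_eq (@set1_inj X)).
Qed.

Lemma even_atoms_not_elementary : ~ elementary even_atoms.
Proof.
(* The successor in the exponent keeps [n] even when the rank is 0; [n] and [n.+1] both reach the
   cutoff but differ in parity. *)
case=> psi psi_P; pose n := 2 ^ (qrank psi).+1.
have le_n : 2 ^ qrank psi <= n by rewrite leq_exp2l.
have evenE k : even_atoms (powerset_structure 'I_k) <-> ~~ odd k.
  by have := even_atoms_powerset 'I_k; rewrite card_ord.
have n_even : ~~ odd n by rewrite oddX.
have : even_atoms (powerset_structure 'I_n.+1).
  apply/psi_P; rewrite -(@powerset_equiv 'I_n) ?card_ord // 1?leqW //.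
  exact/psi_P/evenE.
by move/evenE; rewrite /= n_even.
Qed.

(** * The invariant sentence *)

Section Formulas.

Variable V : vocabulary.

Definition FOr n (phi psi : formula V n) := FNot (FAnd (FNot phi) (FNot psi)).
Definition FImp n (phi psi : formula V n) := FNot (FAnd phi (FNot psi)).
Definition FIff n (phi psi : formula V n) :=
  FAnd (FImp phi psi) (FImp psi phi).
Definition FAll n (phi : formula V n.+1) := FNot (FEx (FNot phi)).

Variable A : structure V.

Lemma sat_or n (phi psi : formula V n) (e : n.-tuple A) :
  sat (FOr phi psi) e = sat phi e || sat psi e.
Proof. by rewrite /= negb_and !negbK. Qed.

Lemma sat_imp n (phi psi : formula V n) (e : n.-tuple A) :
  sat (FImp phi psi) e = (sat phi e ==> sat psi e).
Proof. by rewrite /= negb_and negbK implybE. Qed.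

Lemma sat_iff n (phi psi : formula V n) (e : n.-tuple A) :
  sat (FIff phi psi) e = (sat phi e == sat psi e).
Proof. by rewrite /=; case: (sat phi e); case: (sat psi e). Qed.

Lemma sat_all n (phi : formula V n.+1) (e : n.-tuple A) :
  sat (FAll phi) e = [forall a, sat phi (cons_tuple a e)].
Proof. by rewrite /= negb_exists; apply: eq_forallb => a; rewrite /= negbK. Qed.

Lemma tnth_consS n (a : A) (e : n.-tuple A) i :
  tnth (cons_tuple a e) (lift ord0 i) = tnth e i.
Proof. by rewrite !(tnth_nth a). Qed.

End Formulas.

Definition lo_binary_voc := lo_vocabulary binary_voc.

Section Sentence.

Implicit Types n : nat.

(** Weakening of a variable past one quantifier; [ord0] is the variable bound last. *)
Local Notation "# i" := (lift ord0 i) (at level 9, i at level 9, format "# i").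

Definition edgeF n (i j : 'I_n) : formula lo_binary_voc n :=
  @FRel lo_binary_voc n (Some tt) [tuple i; j].

Definition leF n (i j k : 'I_n) : formula lo_binary_voc n :=
  @FRel lo_binary_voc n None [tuple i; j; k].

Definition eqF n (i j : 'I_n) : formula lo_binary_voc n := FEq _ i j.

Definition bottomF n (i : 'I_n) := FAll (edgeF #i ord0).

Definition atomF n (i : 'I_n) :=
  FAnd (FNot (bottomF i))
    (FAll (FImp (edgeF ord0 #i) (FOr (bottomF ord0) (eqF ord0 #i)))).

Definition atomless_bottomF n (i : 'I_n) :=
  FAnd (bottomF i) (FAll (FImp (atomF ord0) (FNot (edgeF ord0 #i)))).

Definition atom_adjoiningF n : formula lo_binary_voc n :=
  FAll (FAll (FImp (atomF ord0) (FEx (FAll (FImp (atomF ord0)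
    (FIff (edgeF ord0 #ord0)
       (FOr (edgeF ord0 #(#(#ord0))) (eqF ord0 #(#ord0))))))))).

Definition alternatingF n (h b : 'I_n) : formula lo_binary_voc n :=
  FAnd (FAll (FImp (atomF ord0)
         (FImp (FAll (FImp (atomF ord0) (leF #(#h) #ord0 ord0)))
            (edgeF ord0 #b))))
  (FAnd (FAll (FImp (atomF ord0)
          (FImp (FAll (FImp (atomF ord0) (leF #(#h) ord0 #ord0)))
             (FNot (edgeF ord0 #b)))))
    (FAll (FAll (FImp
      (FAnd (FAnd (FAnd (atomF #ord0) (atomF ord0)) (FNot (eqF #ord0 ord0)))
         (leF #(#h) #ord0 ord0))
      (FImp (FAll (FImp (atomF ord0)
               (FOr (leF #(#(#h)) ord0 #(#ord0)) (leF #(#(#h)) #ord0 ord0))))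
         (FIff (edgeF #ord0 #(#b)) (FNot (edgeF ord0 #(#b))))))))).

(** The inner quantifier, over elements, plays the role of a quantifier over sets of atoms. *)
Definition even_atomsF : sentence lo_binary_voc :=
  FAnd (atom_adjoiningF 0)
    (FEx (FAnd (atomless_bottomF ord0) (FEx (alternatingF #ord0 ord0)))).

Variables (A : structure binary_voc) (le : A -> rel A).

Let B : structure lo_binary_voc := lo_expansion le.
Let E := @edge A.

Lemma sat_edgeF n i j (e : n.-tuple B) :
  sat (edgeF i j) e = E (tnth e i) (tnth e j).
Proof.
rewrite /E /edge /= (_ : map_tuple _ _ = [tuple tnth e i; tnth e j]) //.
exact: val_inj.
Qed.

Lemma sat_leF n i j k (e : n.-tuple B) :
  sat (leF i j k) e = le (tnth e i) (tnth e j) (tnth e k).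
Proof. by rewrite /= inE !tnth_map. Qed.

Lemma sat_eqF n i j (e : n.-tuple B) :
  sat (eqF i j) e = (tnth e i == tnth e j).
Proof. by []. Qed.

Lemma sat_bottomF n i (e : n.-tuple B) :
  sat (bottomF i) e = bottom E (tnth e i).
Proof.
rewrite sat_all; apply: eq_forallb => y.
by rewrite sat_edgeF tnth_consS.
Qed.

Lemma sat_not n (phi : formula lo_binary_voc n) (e : n.-tuple B) :
  sat (FNot phi) e = ~~ sat phi e.
Proof. by []. Qed.

Lemma sat_and n (phi psi : formula lo_binary_voc n) (e : n.-tuple B) :
  sat (FAnd phi psi) e = sat phi e && sat psi e.
Proof. by []. Qed.

Lemma sat_ex n (phi : formula lo_binary_voc n.+1) (e : n.-tuple B) :
  sat (FEx phi) e = [exists a, sat phi (cons_tuple a e)].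
Proof. by []. Qed.

Lemma sat_atomF n i (e : n.-tuple B) : sat (atomF i) e = atom E (tnth e i).
Proof.
rewrite sat_and sat_not sat_bottomF sat_all; congr (_ && _).
apply: eq_forallb => y.
by rewrite sat_imp sat_edgeF sat_or sat_bottomF sat_eqF !tnth_consS.
Qed.

Lemma sat_atomless_bottomF n i (e : n.-tuple B) :
  sat (atomless_bottomF i) e = atomless_bottom E (tnth e i).
Proof.
rewrite sat_and sat_bottomF sat_all; congr (_ && _).
apply: eq_forallb => x.
by rewrite sat_imp sat_not sat_atomF sat_edgeF tnth_consS.
Qed.

Lemma sat_atom_adjoiningF n (e : n.-tuple B) :
  sat (atom_adjoiningF n) e = atom_adjoining E.
Proof.
rewrite sat_all; apply: eq_forallb => s.
rewrite sat_all; apply: eq_forallb => a.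
rewrite sat_imp sat_atomF sat_ex; congr (_ ==> _); apply: eq_existsb => s'.
rewrite sat_all; apply: eq_forallb => x.
by rewrite sat_imp sat_iff sat_or sat_atomF !sat_edgeF sat_eqF !tnth_consS.
Qed.

Lemma sat_alternatingF n h b (e : n.-tuple B) :
  sat (alternatingF h b) e =
  alternating (atom E) (le (tnth e h)) (fun x => E x (tnth e b)).
Proof.
rewrite 2!sat_and; congr [&& _, _ & _].
- rewrite sat_all; apply: eq_forallb => x.
  rewrite 2!sat_imp sat_all sat_atomF sat_edgeF !tnth_consS.
  congr (_ ==> _ ==> _); apply: eq_forallb => y.
  by rewrite sat_imp sat_atomF sat_leF !tnth_consS.
- rewrite sat_all; apply: eq_forallb => x.
  rewrite 2!sat_imp sat_not sat_all sat_atomF sat_edgeF !tnth_consS.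
  congr (_ ==> _ ==> _); apply: eq_forallb => y.
  by rewrite sat_imp sat_atomF sat_leF !tnth_consS.
- rewrite sat_all; apply: eq_forallb => x.
  rewrite sat_all; apply: eq_forallb => y.
  rewrite 2!sat_imp 3!sat_and sat_iff 2!sat_not sat_all.
  rewrite 2!sat_atomF sat_eqF sat_leF !sat_edgeF !tnth_consS.
  congr (_ ==> _ ==> _); apply: eq_forallb => z.
  by rewrite sat_imp sat_or sat_atomF !sat_leF !tnth_consS.
Qed.

Lemma models_even_atomsF :
  models B even_atomsF =
  atom_adjoining E && [exists h, atomless_bottom E h &&
    [exists b, alternating (atom E) (le h) (fun x => E x b)]].
Proof.
rewrite /models sat_and sat_atom_adjoiningF sat_ex; congr (_ && _).
apply: eq_existsb => h; rewrite sat_and sat_atomless_bottomF sat_ex.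
congr (_ && _); apply: eq_existsb => b.
by rewrite sat_alternatingF tnth_consS.
Qed.

(** Atoms are not bottoms, so all of them are neighbors of [h] and are linearly ordered by
    [le h]. *)
Lemma bottom_neighbor h x : bottom E h -> x != h -> gaifman h x.
Proof.
move=> /forallP h_bot neq_xh; rewrite /gaifman eq_sym neq_xh.
apply/existsP; exists tt; apply/existsP; exists [tuple h; x].
by rewrite (h_bot x : _ \in _) !inE !eqxx orbT.
Qed.

Lemma models_even_atomsP :
  local_order le -> models B even_atomsF <-> even_atoms A.
Proof.
move=> le_lo; rewrite models_even_atomsF.
have atom_gaifman h x : atomless_bottom E h -> atom E x -> gaifman h x.
  case/andP=> h_bot _ /andP[x_nbot _]; apply: bottom_neighbor => //.
  by apply: contra x_nbot => /eqP ->.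
have lin h : atomless_bottom E h ->
    [/\ {in atom E, reflexive (le h)}, {in atom E &, antisymmetric (le h)},
        {in atom E & &, transitive (le h)} & {in atom E &, total (le h)}].
  move=> h_bot; have [_ le_refl le_anti le_trans le_total] := le_lo h.
  by split=> [x Ax|x y Ax Ay|x y z Ax Ay Az|x y Ax Ay];
    [apply: le_refl | apply: le_anti | apply: le_trans | apply: le_total];
    apply: atom_gaifman.
split=> [/andP[adjoin /existsP[h /andP[h_bot /existsP[b alt_b]]]]|].
  split=> //; first by apply/existsP; exists h.
  have [le_refl le_anti le_trans le_total] := lin h h_bot.
  exact: (alternating_even le_refl le_anti le_trans le_total alt_b).
case=> /existsP[h h_bot] adjoin even_A; apply/andP; split=> //.
apply/existsP; exists h; rewrite h_bot; apply/existsP.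
have [le_refl le_anti le_trans le_total] := lin h h_bot.
(* The alternating predicate is built outside the structure, and representability then turns it into
   an element [b]. *)
have [P alt_P] := even_alternating le_refl le_anti le_trans le_total even_A.
have [b b_P] := atoms_representable P h_bot adjoin; exists b.
by apply: eq_alternating alt_P => x /b_P.
Qed.

End Sentence.

(** A structure in the query must have some expansion satisfying the sentence, so at least one local
    order is required; an enumeration of the universe induces one. *)
Lemma local_order_exists V (A : structure V) :
  exists le : A -> rel A, local_order le.
Proof.
exists (fun a b c => [&& gaifman a b, gaifman a c &
  enum_rank b <= enum_rank c]) => a; split.
- by move=> b c /and3P[-> ->].
- by move=> b b_a; rewrite leqnn (b_a : gaifman a b).
- move=> b c _ _ /andP[/and3P[_ _ le_bc] /and3P[_ _ le_cb]].
  by apply/enum_rank_inj/val_inj/anti_leq; rewrite le_bc.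
- move=> c b d _ _ _ /and3P[-> _ le_bc] /and3P[_ -> le_cd].
  exact: leq_trans le_cd.
- move=> b c b_a c_a; rewrite (b_a : gaifman a b) (c_a : gaifman a c) /=.
  exact: leq_total.
Qed.

Lemma even_atoms_lo_invariant_elementary : lo_invariant_elementary even_atoms.
Proof.
exists even_atomsF => A.
  (* The query is decidable; its boolean form selects which side of invariance holds. *)
  have [sat_A|nsat_A] := boolP
    [&& [exists h, atomless_bottom (@edge A) h], atom_adjoining (@edge A) &
        ~~ odd #|atom (@edge A)|].
    by left=> le le_lo; apply/(models_even_atomsP le_lo)/and3P.
  by right=> le le_lo /(models_even_atomsP le_lo)/and3P; apply/negP.
split=> [even_A|[le le_lo /(models_even_atomsP le_lo)]] //.
have [le le_lo] := local_order_exists A.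
by exists le => //; apply/(models_even_atomsP le_lo).
Qed.

Theorem theorem4p9 :
  exists (V : vocabulary) (J : structure V -> Prop),
    [/\ boolean_query J, lo_invariant_elementary J & ~ elementary J].
Proof.
exists binary_voc, even_atoms; split.
- exact: even_atoms_boolean_query.
- exact: even_atoms_lo_invariant_elementary.
- exact: even_atoms_not_elementary.
Qed.
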